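(* Let $R$ be a (not-necessarily-commutative) ring, and let $A=(a_{ij})$ and $B=(b_{ij})$ be $m\times n$ matrices with elements in $R$. Suppose that for all $i,k\in[m]$ and $j,l\in[n]$ $$[a_{ij},a_{kl}]=0,\qquad [b_{ij},b_{kl}]=0,\qquad [a_{ij},b_{kl}]=-h\,\delta_{ik}\delta_{jl},$$ where $h\in R$. Then, for any positive integer $r$, we have $$\sum_{I\subseteq[m],\,|I|=r}\ \sum_{L\subseteq[n],\,|L|=r}(\det A_{IL})(\det B_{IL}) =\sum_{I\subseteq[n],\,|I|=r}\text{col-det}\bigl[(A^{\mathrm T}B)_{II}+Q_{\rm col}\bigr]$$ $$=\sum_{I\subseteq[n],\,|I|=r}\text{row-det}\bigl[(A^{\mathrm T}B)_{II}+Q_{\rm row}\bigr] =\sum_{I\subseteq[m],\,|I|=r}\text{col-det}\bigl[(AB^{\mathrm T})_{II}+Q_{\rm col}\bigr] =\sum_{I\subseteq[m],\,|I|=r}\text{row-det}\bigl[(AB^{\mathrm T})_{II}+Q_{\rm row}\bigr],$$ where $Q_{\rm col}=h\,\mathrm{diag}(r-1,r-2,\dots,0)$ and $Q_{\rm row}=h\,\mathrm{diag}(0,1,\dots,r-1)$.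
   Context: Notation: $[n]=\{1,\dots,n\}$; $[x,y]=xy-yx$; $M_{IJ}$ is the submatrix of $M$ with rows $I$ and columns $J$ kept in their original (increasing) order; empty sums are $0$. $h\,\delta_{ik}\delta_{jl}$ means $h$ if $i=k$ and $j=l$, and $0$ otherwise. For an $r\times r$ matrix $M$ over a ring, $\text{col-det}\,M=\sum_{\sigma\in\mathcal S_r}\mathrm{sgn}(\sigma)\,M_{\sigma(1)1}M_{\sigma(2)2}\cdots M_{\sigma(r)r}$ and $\text{row-det}\,M=\sum_{\sigma\in\mathcal S_r}\mathrm{sgn}(\sigma)\,M_{1\sigma(1)}M_{2\sigma(2)}\cdots M_{r\sigma(r)}$. When the entries of $M$ commute, both equal the usual determinant $\det M$. *)

(* Defs.v *)
From HB Require Import structures.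
From mathcomp Require Import all_boot all_order all_fingroup all_algebra.

Set Implicit Arguments.
Unset Strict Implicit.
Unset Printing Implicit Defensive.

Import GRing.Theory.
Local Open Scope ring_scope.

(* [R] need not be commutative: [\prod] multiplies in increasing index order. *)
Definition col_det (R : pzRingType) (r : nat) (M : 'M[R]_r) : R :=
  \sum_(s : 'S_r) (-1) ^+ s * \prod_(i < r) M (s i) i.

Definition row_det (R : pzRingType) (r : nat) (M : 'M[R]_r) : R :=
  \sum_(s : 'S_r) (-1) ^+ s * \prod_(i < r) M i (s i).

Notation rsubset n r := {I : {set 'I_n} | #|I| == r}.

Lemma enum_val_ltn (n : nat) (A : {set 'I_n}) (i j : 'I_#|A|) :
  (i < j)%N -> (enum_val i < enum_val j)%N.
Proof.
move=> lt_ij; have x0 : 'I_n := enum_val i.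
rewrite (enum_val_nth x0 i) (enum_val_nth x0 j).
have szA (k : 'I_#|A|) : (k < size (enum A))%N by rewrite -cardE; exact: ltn_ord.
have srt : sorted ltn (map val (enum A)).
  apply: (subseq_sorted ltn_trans _ (iota_ltn_sorted 0 n)).
  rewrite -val_enum_ord; apply: map_subseq.
  by rewrite [enum 'I_n]enumT; exact: filter_subseq.
have := sorted_ltn_nth ltn_trans (val x0) srt.
move=> /(_ i j); rewrite !inE !size_map => /(_ (szA i) (szA j) lt_ij).
by rewrite (nth_map x0) ?(nth_map x0).
Qed.

Definition rsubset_elt (n r : nat) (I : rsubset n r) (i : 'I_r) : 'I_n :=
  enum_val (cast_ord (esym (eqP (valP I))) i).

Definition set_submx (T : Type) (m n r : nat) (M : 'M[T]_(m, n))
    (I : rsubset m r) (L : rsubset n r) : 'M[T]_r :=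
  mxsub (rsubset_elt I) (rsubset_elt L) M.

Definition Qcol (R : pzRingType) (r : nat) (h : R) : 'M[R]_r :=
  h *: diag_mx (\row_(i < r) (r.-1 - i)%:R).

Definition Qrow (R : pzRingType) (r : nat) (h : R) : 'M[R]_r :=
  h *: diag_mx (\row_(i < r) i%:R).

Definition rcommutator (R : pzRingType) (x y : R) : R := x * y - y * x.

Lemma rsubset_elt_ltn (n r : nat) (I : rsubset n r) (i j : 'I_r) :
  (i < j)%N -> (rsubset_elt I i < rsubset_elt I j)%N.
Proof. by move=> lt_ij; exact: enum_val_ltn. Qed.

Lemma mem_rsubset_elt (n r : nat) (I : rsubset n r) (i : 'I_r) :
  rsubset_elt I i \in val I.
Proof. exact: enum_valP. Qed.

(* Main.v *)
Require Import Defs.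
From mathcomp Require Import all_boot all_order all_fingroup all_algebra.

Import GRing.Theory.
Local Open Scope ring_scope.

Set Implicit Arguments.
Unset Strict Implicit.

(** Every sum in the theorem is a sum of normal-ordered expressions, in which
    the entries of [A] stand to the left of those of [B].

    Put [E := A^T *m B], so that [E i j] is the sum over [k] of
    [A k i * B k j]. Normal ordering the product of the [E (f x) (g x)] for [x]
    in a list gives [nprod A B f g], which is a nested sum
    [\sum_k A k (f x) * _ * B k (g x)]; the order of the list is irrelevant to
    it. Multiplying a normal-ordered product on the left by one more
    [E (f x) (g x)] means moving some [B k (g x)] to the right across the
    entries of [A]. Each crossing either passes or leaves an [h]; after summation
    over [k], leaving an [h] at [y] amounts to exchanging the values of [f] at
    [x] and [y] ([contraction]). Under an alternating sum over permutations
    this exchange is a sign, so the contractions add up to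
    [- h * number of factors to the right] on the diagonal. That is exactly
    what the correction [Qcol] cancels, whence [alt_sum_polar_prod] by
    induction on the number of factors.

    So the column determinant is an alternating sum of normal-ordered products
    ([col_det_normal]). The row determinant is the column determinant of the
    same problem in the converse ring, where products are reversed and [A] and
    [B] exchange their roles ([row_det_normal]); its normal-ordered form is the
    previous one reindexed by [s |-> s^-1], so both determinants agree for each
    index set separately ([col_det_row_det]).

    Once everything is normal ordered, only commuting quantities are permuted
    and the usual proof of the Cauchy-Binet formula applies ([alt_sum_nprod]):
    expand over all tuples of row indices, discard by antisymmetry those with a
    repetition, and write the others as an increasing enumeration followed by
    a permutation. Finally [A *m B^T] is [A^T *m B] for the transposed
    matrices, which satisfy the same relations, and the double sum of products
    of minors is symmetric under this transposition.

    The element [h] is not assumed central, but as soon as there are two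
    columns it is a commutator of entries that commute with any given [A k l]
    ([comm_h]); with a single factor no [h] has to be moved. *)

(** * Products of commuting factors and alternating sums *)

(** Both iterated products of commuting factors and the nested sums [nprod]
    below are folds of this kind. *)
Lemma perm_foldr (T : eqType) (S : Type) (op : T -> S -> S) (z : S)
    (s t : seq T) :
    (forall x y a, op x (op y a) = op y (op x a)) ->
  perm_eq s t -> foldr op z s = foldr op z t.
Proof.
move=> opC; elim: s t => [|x s IHs] t st.
  by move: st; rewrite perm_sym => /perm_nilP ->.
have xt : x \in t by rewrite -(perm_mem st) mem_head.
case/splitPr: xt st => t1 t2 st.
have st' : perm_eq s (t1 ++ t2).
  by move: st; rewrite perm_sym perm_catC /= perm_cons perm_catC perm_sym.
rewrite /= (IHs _ st') !foldr_cat /=; elim: t1 {st st'} => //= y t1 <-.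
exact: opC.
Qed.

Lemma perm_comm_prod (R : pzRingType) (T : eqType) (F : T -> R) (s t : seq T) :
    (forall x y, F x * F y = F y * F x) ->
  perm_eq s t -> \prod_(i <- s) F i = \prod_(i <- t) F i.
Proof.
move=> FC st; rewrite !unlock.
by apply: perm_foldr st => x y a /=; rewrite !mulrA FC.
Qed.

Lemma enum_index_enum (T : finType) : enum T = index_enum T.
Proof. by rewrite [index_enum T]unlock enumT. Qed.

Lemma perm_enum_map (T : finType) (s : {perm T}) :
  perm_eq (enum T) (map s (enum T)).
Proof.
apply: uniq_perm; first exact: enum_uniq.
  by rewrite (map_inj_uniq (@perm_inj _ s)) enum_uniq.
by move=> x; rewrite mem_enum -[x](permKV s) map_f ?mem_enum.
Qed.

Lemma reindex_comm_prod (R : pzRingType) (T : finType) (F : T -> R)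
    (s : {perm T}) :
    (forall x y, F x * F y = F y * F x) -> \prod_i F (s i) = \prod_i F i.
Proof.
move=> FC; rewrite -(big_map s xpredT F) -enum_index_enum.
by apply: perm_comm_prod; rewrite // perm_sym perm_enum_map.
Qed.

Lemma alt_sum_tperm (R : pzRingType) (T : finType) (F : {perm T} -> R) (x y : T) :
  x != y ->
  \sum_(s : {perm T}) (-1) ^+ s * F (tperm x y * s)%g
    = - \sum_(s : {perm T}) (-1) ^+ s * F s.
Proof.
move=> xy; rewrite [in RHS](reindex_inj (mulgI (tperm x y))) -sumrN.
by apply: eq_bigr => s _; rewrite odd_mul_tperm xy signr_addb mulN1r mulNr opprK.
Qed.

(** In characteristic 2 an alternating sum equal to its opposite need not
    vanish, so the terms are cancelled in pairs. *)
Lemma alt_sum_eq0 (R : pzRingType) (T : finType) (F : {perm T} -> R) (x y : T) :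
    x != y -> (forall s, F (tperm x y * s)%g = F s) ->
  \sum_(s : {perm T}) (-1) ^+ s * F s = 0.
Proof.
move=> xy FE; rewrite (bigID (fun s : {perm T} => odd_perm s)) /=.
rewrite (reindex_inj (mulgI (tperm x y))) /= -[RHS](addNr
  (\sum_(s : {perm T} | ~~ s) (-1) ^+ s * F s)); congr (_ + _).
rewrite -sumrN; apply: eq_big => [s|s _]; first by rewrite odd_mul_tperm xy.
by rewrite odd_mul_tperm xy signr_addb mulN1r mulNr FE.
Qed.

(** * Normal-ordered products *)

(** The normal-ordered product of the [(A^T *m B) (f j) (g j)] for [j] in [js].
    Nesting the sums keeps one summation index per factor without naming the
    family of all these indices. *)
Definition nprod (R : pzRingType) (m n : nat) (A B : 'M[R]_(m, n))
    (T : Type) (f g : T -> 'I_n) (js : seq T) : R :=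
  foldr (fun j c => \sum_k A k (f j) * c * B k (g j)) 1 js.

Section NormalOrder.
Variables (R : pzRingType) (m n : nat) (A B : 'M[R]_(m, n)).

Lemma eq_in_nprod (T : eqType) (f f' g : T -> 'I_n) (js : seq T) :
  {in js, f =1 f'} -> nprod A B f g js = nprod A B f' g js.
Proof.
elim: js => //= j js IHjs ff'; apply: eq_bigr => k _.
rewrite ff' ?mem_head // IHjs // => i ijs; apply: ff'.
by rewrite inE ijs orbT.
Qed.

Lemma nprod_map (T U : Type) (t : T -> U) (f g : U -> 'I_n) (js : seq T) :
  nprod A B f g (map t js) = nprod A B (f \o t) (g \o t) js.
Proof. by rewrite /nprod foldr_map. Qed.

Hypothesis AA : forall i k j l, A i j * A k l = A k l * A i j.
Hypothesis BB : forall i k j l, B i j * B k l = B k l * B i j.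

(** Two nested sums can be exchanged because the entries of [A] that they put
    outside commute, and so do those of [B]. *)
Lemma perm_nprod (T : eqType) (f g : T -> 'I_n) (js ks : seq T) :
  perm_eq js ks -> nprod A B f g js = nprod A B f g ks.
Proof.
apply: perm_foldr => x y c.
transitivity (\sum_k \sum_l A k (f x) * A l (f y) * c * (B l (g y) * B k (g x))).
  apply: eq_bigr => k _; rewrite mulr_sumr mulr_suml.
  by apply: eq_bigr => l _; rewrite !mulrA.
rewrite exchange_big; apply: eq_bigr => l _; rewrite mulr_sumr mulr_suml.
by apply: eq_bigr => k _; rewrite AA BB !mulrA.
Qed.

Variable h : R.
Hypothesis BA : forall i k j l,
  B i j * A k l = A k l * B i j + h *+ ((k == i) && (l == j)).

(** A derivation rule: the commutator with [B k j] acts on one factor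
    [A l (f s)] at a time, where it gives [h] if [l = k] and [f s = j]. The sum
    over [k] against [A k i] then puts [A l i] where [A l (f s)] was. *)
Lemma Bmul_nprod (T : eqType) (f g : T -> 'I_n) (i j : 'I_n) (js : seq T) :
    (forall k l, h * A k l = A k l * h) -> uniq js ->
  \sum_k A k i * (B k j * nprod A B f g js - nprod A B f g js * B k j)
  = \sum_(s <- js) h *+ (f s == j)
      * nprod A B (fun y => if y == s then i else f y) g js.
Proof.
move=> hA; elim: js => [|y js IHjs] /=.
  by rewrite big_nil big1 // => k _; rewrite mul1r mulr1 subrr mulr0.
case/andP=> yjs /IHjs{}IHjs; rewrite big_cons.
set N := nprod A B f g js in IHjs *.
have Bsum k : B k j * (\sum_l A l (f y) * N * B l (g y))
    - (\sum_l A l (f y) * N * B l (g y)) * B k j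
  = h *+ (f y == j) * N * B k (g y)
    + \sum_l A l (f y) * (B k j * N - N * B k j) * B l (g y).
  rewrite mulr_sumr mulr_suml -sumrB.
  transitivity (\sum_l (h *+ ((l == k) && (f y == j)) * N * B l (g y)
      + A l (f y) * (B k j * N - N * B k j) * B l (g y))).
    apply: eq_bigr => l _; rewrite !mulrA BA !mulrDl mulrBr mulrBl.
    by rewrite -[_ * B l _ * B k _]mulrA [B l _ * _]BB !mulrA addrAC addrC.
  rewrite big_split /= (bigD1 k) //= eqxx big1 ?addr0 // => l /negPf ->.
  by rewrite mulr0n !mul0r.
under eq_bigr => k _ do rewrite Bsum mulrDr.
rewrite big_split /=; congr (_ + _).
  rewrite eqxx mulr_sumr; apply: eq_bigr => k _.
  rewrite (_ : nprod _ _ _ _ _ = N).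
    by rewrite !mulrA !mulrnAr !mulrnAl hA.
  by apply: eq_in_nprod => z zjs; case: eqP zjs yjs => // -> ->.
transitivity (\sum_l A l (f y)
    * (\sum_k A k i * (B k j * N - N * B k j)) * B l (g y)).
  under eq_bigr do rewrite mulr_sumr.
  rewrite exchange_big; apply: eq_bigr => l _; rewrite mulr_sumr mulr_suml.
  by apply: eq_bigr => k _; rewrite !mulrA AA.
rewrite IHjs.
under [LHS]eq_bigr do rewrite mulr_sumr mulr_suml.
rewrite exchange_big /=; apply: eq_big_seq => s sjs; rewrite mulr_sumr.
apply: eq_bigr => l _; case: (y =P s) yjs sjs => [->|_ _ _].
  by case: (s \in js).
by rewrite !mulrA mulrnAr -hA -mulrnAl.
Qed.

(** The first summand comes from moving [B k (g x)] through all the entries of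
    [A], the others from its commutators. As [x] is not in [js], replacing the
    value of [f] at [s] by [f x] and composing [f] with [tperm x s] have the
    same effect on [js]; the second form is the one that permutation sums can
    absorb. An empty [js] involves no commutator, hence the weaker hypothesis
    on [h]. *)
Lemma contraction (T : finType) (f g : T -> 'I_n) (x : T) (js : seq T) :
    ((1 < #|T|)%N -> forall k l, h * A k l = A k l * h) -> uniq (x :: js) ->
  (A^T *m B) (f x) (g x) * nprod A B f g js
  = nprod A B f g (x :: js)
    + \sum_(s <- js) h *+ (f s == g x) * nprod A B (f \o tperm x s) g js.
Proof.
move=> hA xjs; rewrite mxE mulr_suml.
under eq_bigr do rewrite mxE.
case: js xjs => [_|y js xjs].
  by rewrite big_nil addr0; apply: eq_bigr => k _; rewrite !mulr1.
have {}hA : forall k l, h * A k l = A k l * h.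
  apply: hA; rewrite cardE; apply: (@leq_trans (size [:: x, y & js])) => //.
  by apply: uniq_leq_size => // z; rewrite mem_enum.
have xNs := xjs; case/andP: xNs; set ys := y :: js => xNys ys_uniq.
transitivity (\sum_k (A k (f x) * nprod A B f g ys * B k (g x)
   + A k (f x) * (B k (g x) * nprod A B f g ys
                  - nprod A B f g ys * B k (g x)))).
  apply: eq_bigr => k _; rewrite mulrBr !mulrA.
  by rewrite addrC subrK.
rewrite big_split; congr (_ + _); rewrite Bmul_nprod //.
apply: eq_big_seq => s sys; congr (_ * _); apply: eq_in_nprod => z zys /=.
case: tpermP => [zx|->|_ /eqP/negPf->] //.
  by rewrite -zx zys in xNys.
by rewrite eqxx.
Qed.

(** The factors are made normal ordered from right to left. The weight [X]
    stands for the factors on the left that are still to be treated: they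
    depend on the permutation, but not on its values on [js], which is the
    invariance required. The condition on [w] says that the diagonal
    correction of a factor is [h] times the number of factors to its right. *)
Lemma alt_sum_polar_prod (T : finType) (f g : T -> 'I_n) (w : T -> nat)
    (js : seq T) (X : {perm T} -> R) :
    ((1 < #|T|)%N -> forall k l, h * A k l = A k l * h) -> uniq js ->
    map w js = rev (iota 0 (size js)) ->
    (forall x y s, x \in js -> y \in js -> X (tperm x y * s)%g = X s) ->
  \sum_(s : {perm T}) (-1) ^+ s * (X s *
     \prod_(j <- js) ((A^T *m B) (f (s j)) (g j)
                        + h *+ (f (s j) == g j) *+ w j))
  = \sum_(s : {perm T}) (-1) ^+ s * (X s * nprod A B (f \o s) g js).
Proof.
move=> hA; elim: js X => [|x js IHjs] X.
  by move=> _ _ _; apply: eq_bigr => s _; rewrite big_nil.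
move=> xjs_uniq; have [xNjs js_uniq] := andP xjs_uniq.
have -> : size (x :: js) = (size js + 1)%N by rewrite addn1.
rewrite iotaD rev_cat => -[wx wjs] Xinv.
(* The factor at [x] joins the weight while the tail [js] is treated. *)
pose Y s := X s * ((A^T *m B) (f (s x)) (g x) + h *+ (f (s x) == g x) *+ w x).
transitivity (\sum_(s : {perm T}) (-1) ^+ s * (Y s * nprod A B (f \o s) g js)).
  rewrite -IHjs //.
    by apply: eq_bigr => s _; rewrite big_cons !mulrA.
  move=> y z s yjs zjs.
  have xNy : x != y by apply: contraNneq xNjs => ->.
  have xNz : x != z by apply: contraNneq xNjs => ->.
  by rewrite /Y Xinv ?inE ?yjs ?zjs ?orbT // permM tpermD // eq_sym.
(* The correction at [x], counted once; the contraction of [x] with [y] is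
   this term for the permutation with its values at [x] and [y] exchanged. *)
pose Z s := X s * (h *+ (f (s x) == g x) * nprod A B (f \o s) g js).
transitivity (\sum_(s : {perm T})
      (-1) ^+ s * (X s * nprod A B (f \o s) g (x :: js))
    + \sum_(s : {perm T})
        (-1) ^+ s * (\sum_(y <- js) Z (tperm x y * s)%g + Z s *+ size js)).
  rewrite -big_split; apply: eq_bigr => s _ /=; rewrite -mulrDr; congr (_ * _).
  rewrite /Y -mulrA mulrDl (@contraction _ (f \o s) g x js) // -addrA mulrDr.
  congr (_ + _); rewrite mulrDr mulr_sumr; congr (_ + _).
    apply: eq_big_seq => y yjs; rewrite /Z Xinv ?inE ?eqxx ?yjs ?orbT //.
    rewrite permM tpermL; congr (_ * (_ * _)); apply: eq_in_nprod => z _ /=.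
    by rewrite permM.
  by rewrite /Z wx mulrnAl mulrnAr.
rewrite [X in _ + X](_ : _ = 0) ?addr0 //.
under eq_bigr do rewrite mulrDr mulr_sumr.
rewrite big_split exchange_big /=.
rewrite (eq_big_seq (fun=> - \sum_(s : {perm T}) (-1) ^+ s * Z s)); last first.
  by move=> y yjs; rewrite alt_sum_tperm //; apply: contraNneq xNjs => ->.
rewrite big_const_seq count_predT iter_addr_0 mulNrn.
by under [X in _ + X]eq_bigr do rewrite mulrnAr; rewrite sumrMnl addNr.
Qed.

End NormalOrder.

(** * Column and row determinants in normal-ordered form *)

Lemma rsubset_elt_inj (p r : nat) (I : rsubset p r) : injective (rsubset_elt I).
Proof. by move=> i j /enum_val_inj/cast_ord_inj. Qed.

Section CapelliDet.
Variables (R : pzRingType) (m n : nat) (A B : 'M[R]_(m, n)) (h : R).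
Hypothesis AA : forall i k j l, A i j * A k l = A k l * A i j.
Hypothesis BB : forall i k j l, B i j * B k l = B k l * B i j.
Hypothesis BA : forall i k j l,
  B i j * A k l = A k l * B i j + h *+ ((k == i) && (l == j)).

(** With [l' != l], [h] is the commutator of [B k l'] and [A k l'], both of
    which commute with [A k l]. *)
Lemma comm_h : (1 < n)%N -> forall k l, h * A k l = A k l * h.
Proof.
move=> n_gt1 k l; have [l' /negPf l'l] : exists l', l' != l.
  have n_gt0 : (0 < n)%N by apply: ltnW.
  case: (posnP l) => [l0|l_gt0].
    by exists (Ordinal n_gt1); rewrite -val_eqE /= l0.
  by exists (Ordinal n_gt0); rewrite -val_eqE /= ltn_eqF.
have hE : h = B k l' * A k l' - A k l' * B k l'.
  by rewrite BA !eqxx addrC addKr.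
have BlA : B k l' * A k l = A k l * B k l'.
  by rewrite BA eq_sym l'l andbF addr0.
by rewrite hE mulrBl mulrBr -!mulrA BlA [A k l' * A k l]AA !mulrA BlA
  [A k l' * A k l]AA.
Qed.

(** Stated for a list of positions in any order, since the converse ring reads
    the factors from right to left. If [r > 1], the existence of [I] provides
    the two columns that make [h] commute with the entries of [A]. *)
Lemma alt_sum_capelli_prod (r : nat) (I : rsubset n r) (js : seq 'I_r)
    (w : 'I_r -> nat) :
    uniq js -> map w js = rev (iota 0 (size js)) ->
  \sum_(s : 'S_r) (-1) ^+ s * \prod_(j <- js)
     ((A^T *m B) (rsubset_elt I (s j)) (rsubset_elt I j)
        + h *+ (s j == j) *+ w j)
  = \sum_(s : 'S_r) (-1) ^+ s
      * nprod A B (rsubset_elt I \o s) (rsubset_elt I) js.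
Proof.
move=> js_uniq wE.
have hA : (1 < #|{: 'I_r}|)%N -> forall k l, h * A k l = A k l * h.
  rewrite card_ord -(eqP (valP I)) => /leq_trans r_gt1; apply: comm_h.
  by apply: r_gt1; rewrite -[leqRHS]card_ord max_card.
have := alt_sum_polar_prod AA BB BA (rsubset_elt I) (rsubset_elt I)
  (X := fun=> 1) hA js_uniq wE (fun _ _ _ _ _ => erefl).
under eq_bigr do rewrite mul1r.
under [in X in _ = X -> _]eq_bigr do rewrite mul1r.
move=> <-; apply: eq_bigr => s _; congr (_ * _); apply: eq_bigr => j _.
by rewrite (inj_eq (@rsubset_elt_inj _ _ I)).
Qed.

Lemma col_det_normal (r : nat) (I : rsubset n r) :
  col_det (set_submx (A^T *m B) I I + Qcol r h)
  = \sum_(s : 'S_r) (-1) ^+ s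
      * nprod A B (rsubset_elt I \o s) (rsubset_elt I) (enum 'I_r).
Proof.
rewrite -(alt_sum_capelli_prod I (w := fun i => r.-1 - i)%N) ?enum_uniq //.
  apply: eq_bigr => s _; congr (_ * _).
  rewrite enum_index_enum; apply: eq_bigr => j _.
  rewrite !mxE; congr (_ + _); case: eqP => [->|_].
    by rewrite !mulr1n mulr_natr.
  by rewrite !mulr0n mulr0 mul0rn.
rewrite size_enum_ord map_comp val_enum_ord.
apply: (@eq_from_nth _ 0%N); first by rewrite size_rev size_map.
move=> i; rewrite size_map size_iota => ir.
rewrite (nth_map 0%N) ?size_iota // nth_rev ?size_iota // !nth_iota //.
  by rewrite !add0n subnS predn_sub.
by rewrite ltn_subrL (leq_trans _ ir).
Qed.

End CapelliDet.

(** Reversing products turns normal order for the pair [(B, A)] into normal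
    order for the pair [(A, B)]. *)
Lemma nprod_converse (R : pzRingType) (m n : nat) (A B : 'M[R]_(m, n))
    (T : Type) (f g : T -> 'I_n) (js : seq T) :
  nprod (R := R^c) B A f g js = nprod A B g f js.
Proof.
elim: js => //= j js ->; apply: eq_bigr => k _.
exact: (mulrA (A k (g j)) _ (B k (f j))).
Qed.

Section RowCapelli.
Variables (R : pzRingType) (m n : nat) (A B : 'M[R]_(m, n)) (h : R).
Hypothesis AA : forall i k j l, A i j * A k l = A k l * A i j.
Hypothesis BB : forall i k j l, B i j * B k l = B k l * B i j.
Hypothesis BA : forall i k j l,
  B i j * A k l = A k l * B i j + h *+ ((k == i) && (l == j)).

(** The column identity for [B] and [A] in the converse ring: there
    [B^T *m A] has the entries of the transpose of [A^T *m B], and reversing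
    the factors turns the weights [r - 1, ..., 0] into [0, ..., r - 1]. *)
Lemma row_det_normal (r : nat) (I : rsubset n r) :
  row_det (set_submx (A^T *m B) I I + Qrow r h)
  = \sum_(s : 'S_r) (-1) ^+ s
      * nprod A B (rsubset_elt I) (rsubset_elt I \o s) (enum 'I_r).
Proof.
have BAc i k j l : (A i j : R^c) * (B k l : R^c)
    = (B k l : R^c) * (A i j : R^c) + h *+ ((k == i) && (l == j)).
  by rewrite [k == i]eq_sym [l == j]eq_sym; exact: BA.
have /= := alt_sum_capelli_prod (R := R^c) (A := B) (B := A) (h := h)
  (fun i k j l => BB k i l j) (fun i k j l => AA k i l j) BAc I
  (js := rev (enum 'I_r)) (w := val).
rewrite rev_uniq enum_uniq map_rev size_rev size_enum_ord val_enum_ord.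
move=> /(_ isT erefl) capc.
have signc (s : 'S_r) (x : R) :
    ((-1 : R^c) ^+ s : R^c) * (x : R^c) = (-1) ^+ s * x.
  rewrite -[LHS]/(x * _) -[RHS]commr_sign; congr (_ * _).
  by case: (odd_perm s).
transitivity (\sum_(s : 'S_r) ((-1 : R^c) ^+ s : R^c)
    * nprod (R := R^c) B A (rsubset_elt I \o s) (rsubset_elt I)
        (rev (enum 'I_r))).
  rewrite -capc; apply: eq_bigr => s _; rewrite signc; congr (_ * _).
  rewrite rev_prodr revK enum_index_enum; apply: eq_bigr => j _.
  rewrite !mxE; congr (_ + _).
    by apply: eq_bigr => k _; rewrite !mxE.
  rewrite [s j == j]eq_sym; case: (j == s j).
    by rewrite !mulr1n mulr_natr.
  by rewrite !mulr0n mulr0 mul0rn.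
apply: eq_bigr => s _; rewrite signc nprod_converse; congr (_ * _).
by apply: perm_nprod => //; rewrite perm_rev.
Qed.

(** Replacing [s] by its inverse and relabelling the positions by [s] moves the
    permutation from the entries of [A] to those of [B]. *)
Lemma col_det_row_det (r : nat) (I : rsubset n r) :
  col_det (set_submx (A^T *m B) I I + Qcol r h)
  = row_det (set_submx (A^T *m B) I I + Qrow r h).
Proof.
rewrite (col_det_normal AA BB BA) row_det_normal (reindex_inj invg_inj).
apply: eq_bigr => s _; rewrite odd_permV; congr (_ * _).
transitivity (nprod A B (rsubset_elt I \o s^-1%g) (rsubset_elt I)
                 (map s (enum 'I_r))).
  by apply: perm_nprod => //; exact: perm_enum_map.
by rewrite nprod_map; apply: eq_in_nprod => x _ /=; rewrite permK.
Qed.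

End RowCapelli.

(** * The Cauchy-Binet formula for normal-ordered products *)

Lemma det_tr_comm (R : pzRingType) (r : nat) (M : 'M[R]_r) :
    (forall i k j l, M i j * M k l = M k l * M i j) -> \det M^T = \det M.
Proof.
move=> MC; rewrite /determinant (reindex_inj invg_inj); apply: eq_bigr => s _.
rewrite odd_permV; congr (_ * _).
rewrite -(reindex_comm_prod s) => [|x y]; last by rewrite !mxE MC.
by apply: eq_bigr => i _; rewrite mxE permK.
Qed.

Lemma big_cons_tuple (V : nmodType) (T : finType) (r : nat)
    (F : r.+1.-tuple T -> V) :
  \sum_t F t = \sum_x \sum_(t : r.-tuple T) F [tuple of x :: t].
Proof.
rewrite pair_big (reindex (fun p : T * r.-tuple T => [tuple of p.1 :: p.2])) //.
exists (fun t => (thead t, [tuple of behead t])) => [[x t] _|t _] /=.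
  by congr (_, _); rewrite ?theadE //; apply: val_inj.
by rewrite -tuple_eta.
Qed.

(** Injectivity suffices because [L] has only [r] elements. *)
Lemma imset_rsubset (p r : nat) (L : rsubset p r) (u : 'I_r -> 'I_p) :
  injective u -> (forall i, u i \in val L) -> [set u i | i in 'I_r] = val L.
Proof.
move=> u_inj uL; apply/eqP; rewrite eqEcard card_imset // card_ord (eqP (valP L)).
by rewrite leqnn andbT; apply/subsetP => _ /imsetP[i _ ->].
Qed.

(** A tuple without repetition is the increasing enumeration of the set of its
    entries, permuted in a unique way. *)
Lemma sum_inj_tuple (V : nmodType) (p r : nat) (F : r.-tuple 'I_p -> V) :
  \sum_(t : r.-tuple 'I_p | injectiveb (tnth t)) F t
  = \sum_(L : rsubset p r) \sum_(s : 'S_r) F [tuple rsubset_elt L (s i) | i < r].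
Proof.
rewrite pair_big /=.
pose e (q : rsubset p r * 'S_r) := [tuple rsubset_elt q.1 (q.2 i) | i < r].
have eE q i : tnth (e q) i = rsubset_elt q.1 (q.2 i) by rewrite tnth_mktuple.
have e_inj q : injective (tnth (e q)).
  by move=> i j; rewrite !eE => /rsubset_elt_inj/perm_inj.
have eL q i : tnth (e q) i \in val q.1 by rewrite eE mem_rsubset_elt.
transitivity (\sum_(q in [set: rsubset p r * 'S_r]) F (e q)); last first.
  by apply: eq_bigl => q; rewrite inE.
rewrite -(big_imset F (h := e)) /=; last first.
  move=> [L s] [L' s'] _ _ ee.
  have LL' : L = L'.
    apply: val_inj.
    rewrite /= -(imset_rsubset (@e_inj (L, s)) (eL (L, s))) ee.
    exact: (imset_rsubset (@e_inj (L', s')) (eL (L', s'))).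
  congr (_, _) => //; apply/permP => i; apply: (@rsubset_elt_inj _ _ L).
  by have := congr1 (fun t => tnth t i) ee; rewrite !eE /= LL'.
apply: eq_bigl => t; apply/injectiveP/imsetP => [t_inj|[q _ ->]]; last exact: e_inj.
have cardL : #|[set tnth t i | i in 'I_r]| == r by rewrite card_imset // card_ord.
pose L : rsubset p r := exist (fun I : {set 'I_p} => #|I| == r) _ cardL.
have /tuple_permP[s ts] : perm_eq t [tuple rsubset_elt L i | i < r].
  have Luniq : uniq [tuple rsubset_elt L i | i < r].
    by rewrite map_inj_uniq ?enum_uniq //; exact: rsubset_elt_inj.
  have tuniq : uniq t by apply/tuple_uniqP.
  have Lt : {subset [tuple rsubset_elt L i | i < r] <= t}.
    move=> _ /mapP[i _ ->]; have /imsetP[j _ ->] := mem_rsubset_elt L i.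
    exact: mem_tnth.
  rewrite perm_sym; apply: uniq_perm => //.
  by have [] := uniq_min_size Luniq Lt; rewrite !size_tuple.
exists (L, s); first by rewrite inE.
rewrite (val_inj ts : t = [tuple _ | i < r]).
by apply: eq_from_tnth => i; rewrite eE !tnth_mktuple.
Qed.

Section CauchyBinet.
Variables (R : pzRingType) (m n : nat) (A B : 'M[R]_(m, n)).
Hypothesis AA : forall i k j l, A i j * A k l = A k l * A i j.
Hypothesis BB : forall i k j l, B i j * B k l = B k l * B i j.

Lemma nprod_expand (r : nat) (f g : 'I_r -> 'I_n) :
  nprod A B f g (enum 'I_r)
  = \sum_(t : r.-tuple 'I_m)
      \prod_j A (tnth t j) (f j) * \prod_j B (tnth t j) (g j).
Proof.
elim: r f g => [|r IHr] f g.
  rewrite (big_pred1 [tuple]) => [|t]; last exact/esym/eqP/tuple0.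
  by rewrite !big_ord0 mulr1 enum_ord0.
rewrite enum_ordSl /= big_cons_tuple; apply: eq_bigr => k _.
rewrite nprod_map IHr mulr_sumr mulr_suml; apply: eq_bigr => t _.
rewrite !big_ord_recl !tnth0.
under [in RHS]eq_bigr do rewrite tnthS.
under [X in _ = _ * (_ * X)]eq_bigr do rewrite tnthS.
rewrite -!mulrA; congr (_ * (_ * _)).
by apply/esym/commr_prod => j _; exact: BB.
Qed.

(** The entries of [A] carry the antisymmetry, which kills the tuples with a
    repetition. For the tuple given by [L] and [s] they contribute the minor of
    [A] with the sign of [s]; the sum over [s] then turns the entries of [B]
    into the other minor, in column form. *)
Lemma alt_sum_nprod (r : nat) (f g : 'I_r -> 'I_n) :
  \sum_(s : 'S_r) (-1) ^+ s * nprod A B (f \o s) g (enum 'I_r)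
  = \sum_(L : rsubset m r)
      \det (mxsub (rsubset_elt L) f A) * \det (mxsub (rsubset_elt L) g B).
Proof.
pose a (t : r.-tuple 'I_m) :=
  \sum_(s : 'S_r) (-1) ^+ s * \prod_j A (tnth t j) (f (s j)).
transitivity (\sum_t a t * \prod_j B (tnth t j) (g j)).
  under eq_bigr do rewrite nprod_expand mulr_sumr.
  rewrite exchange_big; apply: eq_bigr => t _; rewrite mulr_suml.
  by apply: eq_bigr => s _; rewrite mulrA.
rewrite (bigID (fun t => injectiveb (tnth t))) /= [X in _ + X]big1 ?addr0.
  rewrite sum_inj_tuple; apply: eq_bigr => L _.
  rewrite -[\det (mxsub _ g B)]det_tr_comm => [|*]; last by rewrite !mxE BB.
  rewrite mulr_sumr; apply: eq_bigr => s _.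
  have -> : a [tuple rsubset_elt L (s i) | i < r]
      = (-1) ^+ s * \det (mxsub (rsubset_elt L) f A).
    rewrite /a (reindex_inj (mulgI s)) mulr_sumr; apply: eq_bigr => u _.
    rewrite odd_permM signr_addb -!mulrA; congr (_ * (_ * _)).
    rewrite -[RHS](reindex_comm_prod s) => [|x y]; last by rewrite !mxE AA.
    by apply: eq_bigr => j _; rewrite tnth_mktuple mxE permM.
  rewrite -commr_sign -!mulrA; congr (_ * (_ * _)).
  by apply: eq_bigr => j _; rewrite tnth_mktuple !mxE.
move=> t /injectivePn[x [y xy txy]].
rewrite [a t](alt_sum_eq0 xy) ?mul0r // => s.
rewrite -[RHS](reindex_comm_prod (tperm x y)) => [|i j]; last by rewrite AA.
apply: eq_bigr => j _; rewrite permM; congr (A _ _).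
by case: tpermP => // ->.
Qed.

End CauchyBinet.

(** * The Capelli identities *)

Lemma capelli_cauchy_binet (R : pzRingType) (m n : nat) (A B : 'M[R]_(m, n))
    (h : R) :
    (forall i k j l, A i j * A k l = A k l * A i j) ->
    (forall i k j l, B i j * B k l = B k l * B i j) ->
    (forall i k j l,
      B i j * A k l = A k l * B i j + h *+ ((k == i) && (l == j))) ->
  forall (r : nat) (I : rsubset n r),
  col_det (set_submx (A^T *m B) I I + Qcol r h)
  = \sum_(L : rsubset m r) \det (set_submx A L I) * \det (set_submx B L I).
Proof.
by move=> AA BB BA r I; rewrite (col_det_normal AA BB BA) (alt_sum_nprod AA BB).
Qed.

Theorem corollary1p3 (R : pzRingType) (m n : nat) (A B : 'M[R]_(m, n)) (h : R)
    (hAA : forall (i k : 'I_m) (j l : 'I_n), rcommutator (A i j) (A k l) = 0)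
    (hBB : forall (i k : 'I_m) (j l : 'I_n), rcommutator (B i j) (B k l) = 0)
    (hAB : forall (i k : 'I_m) (j l : 'I_n),
      rcommutator (A i j) (B k l) = - (if (i == k) && (j == l) then h else 0))
    (r : nat) (r_gt0 : (0 < r)%N) :
  [/\ \sum_(I : rsubset m r) \sum_(L : rsubset n r)
        \det (set_submx A I L) * \det (set_submx B I L)
      = \sum_(I : rsubset n r) col_det (set_submx (A^T *m B) I I + Qcol r h),
      \sum_(I : rsubset n r) col_det (set_submx (A^T *m B) I I + Qcol r h)
      = \sum_(I : rsubset n r) row_det (set_submx (A^T *m B) I I + Qrow r h),
      \sum_(I : rsubset n r) row_det (set_submx (A^T *m B) I I + Qrow r h)
      = \sum_(I : rsubset m r) col_det (set_submx (A *m B^T) I I + Qcol r h)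
    & \sum_(I : rsubset m r) col_det (set_submx (A *m B^T) I I + Qcol r h)
      = \sum_(I : rsubset m r) row_det (set_submx (A *m B^T) I I + Qrow r h)].
Proof.
have AA i k j l : A i j * A k l = A k l * A i j by apply: subr0_eq (hAA i k j l).
have BB i k j l : B i j * B k l = B k l * B i j by apply: subr0_eq (hBB i k j l).
have BA i k j l :
    B i j * A k l = A k l * B i j + h *+ ((k == i) && (l == j)).
  have /eqP := hAB k i l j; rewrite subr_eq addrC -subr_eq opprK => /eqP <-.
  by case: (_ && _).
have ATA i k j l : A^T i j * A^T k l = A^T k l * A^T i j by rewrite !mxE.
have BTB i k j l : B^T i j * B^T k l = B^T k l * B^T i j by rewrite !mxE.
have BAT i k j l :
    B^T i j * A^T k l = A^T k l * B^T i j + h *+ ((k == i) && (l == j)).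
  by rewrite !mxE BA andbC.
have detT (M : 'M[R]_(m, n))
    (MC : forall i k j l, M i j * M k l = M k l * M i j)
    (I : rsubset m r) (L : rsubset n r) :
    \det (set_submx M^T L I) = \det (set_submx M I L).
  rewrite -[RHS]det_tr_comm => [|*]; last by rewrite !mxE MC.
  by congr (\det _); apply/matrixP => i j; rewrite !mxE.
have cb : \sum_(I : rsubset m r) \sum_(L : rsubset n r)
      \det (set_submx A I L) * \det (set_submx B I L)
    = \sum_(I : rsubset n r) col_det (set_submx (A^T *m B) I I + Qcol r h).
  rewrite exchange_big; apply: eq_bigr => I _.
  by rewrite (capelli_cauchy_binet AA BB BA).
have colrow : \sum_(I : rsubset n r) col_det (set_submx (A^T *m B) I I + Qcol r h)
    = \sum_(I : rsubset n r) row_det (set_submx (A^T *m B) I I + Qrow r h).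
  by apply: eq_bigr => I _; apply: col_det_row_det.
have AE : A *m B^T = A^T^T *m B^T by rewrite trmxK.
split=> //; rewrite AE.
  rewrite -colrow -cb; apply: eq_bigr => I _.
  rewrite (capelli_cauchy_binet ATA BTB BAT); apply: eq_bigr => L _.
  by rewrite !detT.
by apply: eq_bigr => I _; rewrite (col_det_row_det ATA BTB BAT I).
Qed.
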